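(* Let $m,n$ be positive integers. $J(\mathbf{P}_{m,n})$ under rowmotion and the set of $(m,n)$-partial fully-packed loop configurations under gyration are in equivariant bijection: there is a bijection $\Phi$ from the set of $(m,n)$-partial fully-packed loop configurations to $J(\mathbf{P}_{m,n})$ such that $\Phi(G(F))=\mathrm{Row}(\Phi(F))$ for every configuration $F$.
   Context: The poset $\mathbf{P}_{m,n}$ has elements the integer triples $(i,j,k)$ with $0\le k\le m-1$, $k\le j\le n-1$, $k\le i\le m-1$, and partial order generated by the covering relations: $(i,j,k)$ covers each of $(i+1,j,k)$, $(i,j+1,k)$, $(i-1,j,k-1)$, $(i,j-1,k-1)$ that is an element of $\mathbf{P}_{m,n}$. $J(P)$ is the set of order ideals of $P$. Rowmotion $\mathrm{Row}:J(P)\to J(P)$ sends $X$ to the order ideal generated by the minimal elements of $P\setminus X$. The graph $G_{m,n}$ has vertex set $\{v_{i,j}:0\le i\le m+1,\ 0\le j\le n+1\}\setminus\{v_{0,0},v_{0,n+1},v_{m+1,0},v_{m+1,n+1}\}$ and edges $v_{i,j}v_{i+1,j}$ for $0\le i\le m$, $1\le j\le n$, and $v_{i,j}v_{i,j+1}$ for $1\le i\le m$, $0\le j\le n$ ($i$ indexes rows from the top, $j$ columns from the left). Vertices $v_{i,j}$ with $1\le i\le m$, $1\le j\le n$ are interior. An $(m,n)$-partial fully-packed loop configuration is a subgraph of $G_{m,n}$ (on all vertices) such that every interior vertex has exactly two incident edges, and: for $1\le j\le n$ the edge $v_{0,j}v_{1,j}$ is present iff $j$ is odd, and for $1\le i\le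 m$ the edge $v_{i,0}v_{i,1}$ is present iff $i$ is even. Squares: for $0\le i\le m$, $0\le j\le n$, the square $Q_{i,j}$ has upper-left corner $v_{i,j}$; its sides are top $v_{i,j}v_{i,j+1}$, bottom $v_{i+1,j}v_{i+1,j+1}$, left $v_{i,j}v_{i+1,j}$, right $v_{i,j+1}v_{i+1,j+1}$ (those that are edges of $G_{m,n}$). $Q_{i,j}$ is even if $i+j$ is even, odd otherwise. The local action on $Q_{i,j}$ (for a configuration $F$, looking at which sides of $Q_{i,j}$ are edges of $F$): if $i=0$ or $j=0$ (boundary square), do nothing. If $1\le i\le m-1$, $1\le j\le n-1$ (interior square): if the sides in $F$ are exactly $\{$top, bottom$\}$, replace them by $\{$left, right$\}$, and vice versa. If $1\le i\le m-1$, $j=n$ (right exterior): swap exactly $\{$left$\}$ with exactly $\{$top, bottom$\}$. If $i=m$, $1\le j\le n-1$ (bottom exterior): swap exactly $\{$top$\}$ with exactly $\{$left, right$\}$. If $i=m$, $j=n$: swap exactly $\{$left$\}$ with exactly $\{$top$\}$. In all other cases do nothing. Gyration $G$ applies the local action to all even squares, then to all odd squares; it maps partial fully-packed loop configurations to partial fully-packed loop configurations. *)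

(* Defs.v *)
From mathcomp Require Import all_boot.
Set Implicit Arguments. Unset Strict Implicit. Unset Printing Implicit Defensive.

Definition Tri (m n : nat) := ('I_m * 'I_n * 'I_m)%type.

Definition inP m n (x : Tri m n) : bool :=
  ((x.2 : nat) <= x.1.2) && ((x.2 : nat) <= x.1.1).

(* lowerP x y <=> x and y are elements of P_{m,n} and x covers y. *)
Definition lowerP m n : rel (Tri m n) := fun x y =>
  [&& inP x, inP y &
   [|| [&& (y.1.1 : nat) == (x.1.1 : nat).+1, (y.1.2 : nat) == x.1.2 & (y.2 : nat) == x.2],
       [&& (y.1.1 : nat) == x.1.1, (y.1.2 : nat) == (x.1.2 : nat).+1 & (y.2 : nat) == x.2],
       [&& (y.1.1 : nat).+1 == x.1.1, (y.1.2 : nat) == x.1.2 & (y.2 : nat).+1 == x.2]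
     | [&& (y.1.1 : nat) == x.1.1, (y.1.2 : nat).+1 == x.1.2 & (y.2 : nat).+1 == x.2]]].

Definition leP m n (y x : Tri m n) : bool := connect (@lowerP m n) x y.

Definition is_ideal m n (X : {set Tri m n}) : Prop :=
  (forall x, x \in X -> inP x) /\
  (forall x y, x \in X -> leP y x -> y \in X).

Definition minimal_out m n (X : {set Tri m n}) (x : Tri m n) : bool :=
  [&& inP x, x \notin X &
      [forall y, (inP y && (y \notin X) && leP y x) ==> (y == x)]].

Definition rowmotion m n (X : {set Tri m n}) : {set Tri m n} :=
  [set y | [exists x, minimal_out X x && leP y x]].

(* An edge (a, b, true) is the horizontal edge v_{a,b} v_{a,b+1};
   an edge (a, b, false) is the vertical edge v_{a,b} v_{a+1,b}. *)
Definition Edge (m n : nat) := ('I_m.+2 * 'I_n.+2 * bool)%type.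

Definition valid_edge m n (e : Edge m n) : bool :=
  if e.2 then [&& 1 <= (e.1.1 : nat), (e.1.1 : nat) <= m & (e.1.2 : nat) <= n]
  else [&& (e.1.1 : nat) <= m, 1 <= (e.1.2 : nat) & (e.1.2 : nat) <= n].

Definition hasE m n (F : {set Edge m n}) (a b : nat) (h : bool) : bool :=
  [exists e in F, [&& (e.1.1 : nat) == a, (e.1.2 : nat) == b & e.2 == h]].

(* number of edges of F incident to the vertex v_{a,b} (for interior a, b >= 1) *)
Definition degree m n (F : {set Edge m n}) (a b : nat) : nat :=
  hasE F a b true + hasE F a b.-1 true + hasE F a b false + hasE F a.-1 b false.

Definition is_pfpl m n (F : {set Edge m n}) : Prop :=
  [/\ (forall e, e \in F -> valid_edge e),
      (forall a b, 1 <= a <= m -> 1 <= b <= n -> degree F a b = 2),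
      (forall j, 1 <= j <= n -> hasE F 0 j false = odd j)
    & (forall i, 1 <= i <= m -> hasE F i 0 true = ~~ odd i)].

(* Local action on the sides (top, bottom, left, right) of Q_{i,j}. *)
Definition local_sides (m n i j : nat) (s : bool * bool * bool * bool)
  : bool * bool * bool * bool :=
  let: (t, bo, l, r) := s in
  if (i == 0) || (j == 0) then s
  else if (i < m) && (j < n) then
    (if [&& t, bo, ~~ l & ~~ r] then (false, false, true, true)
     else if [&& ~~ t, ~~ bo, l & r] then (true, true, false, false)
     else s)
  else if (i < m) && (j == n) then
    (if [&& ~~ t, ~~ bo, l & ~~ r] then (true, true, false, false)
     else if [&& t, bo, ~~ l & ~~ r] then (false, false, true, false)
     else s)
  else if (i == m) && (j < n) then
    (if [&& t, ~~ bo, ~~ l & ~~ r] then (false, false, true, true)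
     else if [&& ~~ t, ~~ bo, l & r] then (true, false, false, false)
     else s)
  else if (i == m) && (j == n) then
    (if [&& ~~ t, ~~ bo, l & ~~ r] then (true, false, false, false)
     else if [&& t, ~~ bo, ~~ l & ~~ r] then (false, false, true, false)
     else s)
  else s.

Definition local_action m n (F : {set Edge m n}) (ij : nat * nat) : {set Edge m n} :=
  let: (i, j) := ij in
  let: (t', bo', l', r') :=
    local_sides m n i j (hasE F i j true, hasE F i.+1 j true,
                         hasE F i j false, hasE F i j.+1 false) in
  [set e : Edge m n |
    let a := (e.1.1 : nat) in let b := (e.1.2 : nat) in
    if e.2 then
      (if (a == i) && (b == j) then t'
       else if (a == i.+1) && (b == j) then bo'
       else e \in F)
    else
      (if (a == i) && (b == j) then l'
       else if (a == i) && (b == j.+1) then r'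
       else e \in F)].

Definition squares (m n : nat) : seq (nat * nat) :=
  [seq (i, j) | i <- iota 0 m.+1, j <- iota 0 n.+1].

Definition even_squares m n := [seq p <- squares m n | ~~ odd (p.1 + p.2)].
Definition odd_squares m n := [seq p <- squares m n | odd (p.1 + p.2)].

(* Gyration: local action on all even squares, then on all odd squares.
   (Local actions on squares of the same parity act on disjoint sets of
   edges, so the order within each parity class is irrelevant.) *)
Definition gyration m n (F : {set Edge m n}) : {set Edge m n} :=
  foldl (@local_action m n) (foldl (@local_action m n) F (even_squares m n))
        (odd_squares m n).

(* Main.v *)
Require Import Defs.
From mathcomp Require Import all_boot.
From mathcomp Require Import zify.

(** A configuration is encoded by a height function on the squares, with
h(0,j) = j, h(i,0) = i and unit steps, or equivalently by the corner sums
c = (i + j - h) / 2.  Setting (i,j,k) in X iff k < c(i+1,j+1) identifies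
configurations with order ideals, and the local action on a square becomes
reflection of h at a local extremum, i.e. toggling all poset elements over that
square.  Gyration therefore toggles all even ranks and then all odd ranks, while
rowmotion toggles the ranks successively from the top.  The bijection records an
element of corank q in the state reached after q half-steps of gyration: just
before it is toggled for the first time after its upper covers have been.  With
this shift in time both maps satisfy the same recursion on the rank.  It is
injective because its values along the orbit of F determine a late iterate of
gyration, and surjective because both finite sets have the same cardinality. *)

Set Implicit Arguments. Unset Strict Implicit. Unset Printing Implicit Defensive.

Section Configurations.
Variables m n : nat.
Implicit Types (c : nat -> nat -> nat) (F : {set Edge m n}) (X : {set Tri m n}).

(** * Configurations as corner sums on squares *)

Definition corner_sum c : Prop :=
  [/\ forall j, j <= n -> c 0 j = 0,
      forall i, i <= m -> c i 0 = 0,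
      forall i j, i < m -> j <= n -> c i j <= c i.+1 j <= (c i j).+1
    & forall i j, i <= m -> j < n -> c i j <= c i j.+1 <= (c i j).+1].

(** The value [c i j] sits on the square $Q_{i,j}$. Each edge separates two squares, and the jump of
    [c] across it decides its presence, with a convention that alternates with the parity of
    [a + b]. *)
Definition edge_of c (a b : nat) (h : bool) : bool :=
  if h then [&& 1 <= a, a <= m & b <= n] && ((c a b != c a.-1 b) == odd (a + b))
  else [&& a <= m, 1 <= b & b <= n] && ((c a b != c a b.-1) != odd (a + b)).

Arguments edge_of : simpl never.

Definition config_of c : {set Edge m n} := [set e : Edge m n | edge_of c e.1.1 e.1.2 e.2].

Definition corner_of F (i j : nat) : nat :=
  \sum_(1 <= b < j.+1) (hasE F i b false (+) odd (i + b)).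

Lemma hasE_ord F (e : Edge m n) : hasE F e.1.1 e.1.2 e.2 = (e \in F).
Proof.
apply/existsP/idP => [[f /andP[fF /and3P[/eqP h1 /eqP h2 /eqP h3]]]|eF].
  case: f e fF h1 h2 h3 => [[a b] h] [[a' b'] h'] /= fF /val_inj <- /val_inj <- <-.
  by [].
by exists e; rewrite eF !eqxx.
Qed.

Lemma hasE_config_of c a b h : hasE (config_of c) a b h = edge_of c a b h.
Proof.
(* The coordinates are arbitrary naturals; outside the ranges of the ordinals both sides are
   false. *)
have [[la lb]|nl] : (a < m.+2 /\ b < n.+2) \/ ~~ ((a < m.+2) && (b < n.+2)) by lia.
  by rewrite (@hasE_ord (config_of c) (Ordinal la, Ordinal lb, h)) inE.
transitivity false.
  apply/negbTE/existsP => -[[[x y] h1]] /andP[_ /= /and3P[/eqP ex /eqP ey _]].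
  by move: nl; rewrite -ex -ey !ltn_ord.
by apply/esym/negbTE; rewrite /edge_of; case: h; lia.
Qed.

Lemma eq_config_of c c' :
  (forall i j, i <= m -> j <= n -> c i j = c' i j) -> config_of c = config_of c'.
Proof.
move=> E; apply/setP => -[[a b] h]; rewrite !inE /edge_of /=.
case: h; case: and3P => //= -[h1 h2 h3]; rewrite !E //; lia.
Qed.

(** Of the four squares around an interior vertex, the upper left and lower right ones are joined by
    two monotone paths with equal total increment. The parity convention complements the edges
    crossed by exactly one of the paths, so two of the four edges are present. *)
Lemma config_of_pfpl c : corner_sum c -> is_pfpl (config_of c).
Proof.
case=> c0 c0' cv ch; split.
- move=> [[a b] h]; rewrite inE /edge_of /valid_edge /=.
  by case: h => /andP[].
- case=> [|a] [|b] // ha hb; rewrite /degree !hasE_config_of /edge_of /=.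
  rewrite ?addnS ?addSn /= ?negbK.
  have := cv a b; have := cv a b.+1; have := ch a b; have := ch a.+1 b.
  have -> : a < m by lia. have -> : b < n by lia.
  have -> : b <= n by lia. have -> : a <= m by lia.
  move=> /(_ isT isT) h1 /(_ isT isT) h2 /(_ isT isT) h3 /(_ isT isT) h4.
  case: (odd (a + b)); lia.
- move=> [|j] // /andP[_ jn]; rewrite hasE_config_of /edge_of /= jn !c0 //=; lia.
- move=> [|i] // /andP[_ im]; rewrite hasE_config_of /edge_of /= im !c0' //=; last lia.
  by rewrite addn0 /=; case: (odd i).
Qed.

Lemma corner_ofS F i j :
  corner_of F i j.+1 = corner_of F i j + (hasE F i j.+1 false (+) odd (i + j.+1)).
Proof. by rewrite /corner_of big_nat_recr. Qed.

(* Degree two at an interior vertex says that the increments of the corner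
   sum around it add up to zero. *)
Lemma corner_of_vertical F i j : is_pfpl F -> i < m -> j <= n ->
  corner_of F i.+1 j = corner_of F i j + (hasE F i.+1 j true == odd (i.+1 + j)).
Proof.
case=> _ hdeg _ hleft im.
elim: j => [_|j IH jn].
  rewrite /corner_of !big_geq // hleft; last lia.
  by rewrite addn0; case: (odd _).
rewrite !corner_ofS IH; last lia.
have := hdeg i.+1 j.+1; rewrite /degree im jn => /(_ isT isT) /=.
rewrite ?addnS ?addSn /=.
case: (hasE F i.+1 j.+1 true); case: (hasE F i.+1 j true);
case: (hasE F i.+1 j.+1 false); case: (hasE F i j.+1 false);
  case: (odd _) => //=; lia.
Qed.

Lemma corner_of_corner_sum F : is_pfpl F -> corner_sum (corner_of F).
Proof.
move=> pF; split.
- case: pF => _ _ htop _; elim=> [|j IH] jn; first by rewrite /corner_of big_geq.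
  by rewrite corner_ofS htop // IH ?addbb //; lia.
- by move=> i _; rewrite /corner_of big_geq.
- move=> i j im jn; rewrite corner_of_vertical //; case: (_ == _); lia.
- move=> i j im jn; rewrite corner_ofS; case: (_ (+) _); lia.
Qed.

Lemma corner_ofK F : is_pfpl F -> config_of (corner_of F) = F.
Proof.
move=> pF; apply/setP => -[[a b] h]; rewrite inE -hasE_ord /edge_of /=.
case: (pF) => hval _ _ _.
have hv : hasE F a b h -> valid_edge (a, b, h).
  by rewrite (hasE_ord F (a, b, h)) => /hval.
rewrite /valid_edge /= in hv.
case: h hv => /=; case: and3P => [[h1 h2 h3] _|_ hv]; rewrite ?andTb ?andFb;
  try by case: hasE hv => // /(_ isT).
- case: (nat_of_ord a) h1 h2 => // i _ im.
  rewrite [i.+1.-1]/= corner_of_vertical //.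
  by case: hasE; case: (odd _); rewrite /= ?addn0 ?addn1; lia.
- case: (nat_of_ord b) h2 h3 => // j _ jn.
  rewrite [j.+1.-1]/= corner_ofS.
  by case: hasE; case: (odd _); rewrite /= ?addn0 ?addn1; lia.
Qed.

Lemma config_ofK c i j : corner_sum c -> i <= m -> j <= n ->
  corner_of (config_of c) i j = c i j.
Proof.
case=> c0 c0' cv ch im; elim: j => [|j IH] jn.
  by rewrite c0' // /corner_of big_geq.
rewrite corner_ofS IH; last lia.
rewrite hasE_config_of /edge_of /= im jn /=.
have := ch i j im jn; case: (odd _); lia.
Qed.

Lemma corner_sum_le c i j : corner_sum c -> i <= m -> j <= n ->
  (c i j <= i) && (c i j <= j).
Proof.
case=> c0 c0' cv ch.
have hi : forall k, k <= m -> j <= n -> c k j <= k.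
  elim=> [|k IH] km jn; first by rewrite c0.
  by have := cv k j km jn; have := IH (ltnW km) jn; lia.
have hj : forall k, i <= m -> k <= n -> c i k <= k.
  move=> k im; elim: k => [|k IH] kn; first by rewrite c0'.
  by have := ch i k im kn; have := IH (ltnW kn); lia.
by move=> im jn; rewrite hi ?hj.
Qed.

(** * Local actions as flips of corner sums *)

(** A local maximum of the height $i+j-2c$: only there can [c i j] grow by one and keep all steps
    admissible. For [i = m] or [j = n] the missing neighbour imposes nothing. *)
Definition raisable c i j : bool :=
  [&& c i j == c i.-1 j, c i j == c i j.-1,
      (i < m) ==> (c i.+1 j != c i j) & (j < n) ==> (c i j.+1 != c i j)].

Definition lowerable c i j : bool :=
  [&& c i j != c i.-1 j, c i j != c i j.-1,
      (i < m) ==> (c i.+1 j == c i j) & (j < n) ==> (c i j.+1 == c i j)].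

Definition flip c (i j : nat) : nat :=
  if (i == 0) || (j == 0) then c i j
  else if raisable c i j then (c i j).+1
  else if lowerable c i j then (c i j).-1
  else c i j.

Definition flip_on (s : pred (nat * nat)) c (i j : nat) : nat :=
  if s (i, j) then flip c i j else c i j.

(** Every side of the square compares [c i j] with one neighbour, so changing [c i j] alone
    complements all existing sides at once, which is what the local action does when it acts. *)
Lemma local_action_config_of c i j : corner_sum c -> i <= m -> j <= n ->
  local_action (config_of c) (i, j) = config_of (flip_on (pred1 (i, j)) c).
Proof.
move=> Hc im jn; apply/setP => -[[a b] h].
rewrite /local_action !hasE_config_of.
case Z : ((i == 0) || (j == 0)).
  rewrite /local_sides Z !inE /=.
  have -> : edge_of (flip_on (pred1 (i, j)) c) a b h = edge_of c a b h.
    suff E x y : flip_on (pred1 (i, j)) c x y = c x y by rewrite /edge_of !E.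
    by rewrite /flip_on /=; case: eqP => // -[-> ->]; rewrite /flip Z.
  by case: h; case: andP => [[/eqP -> /eqP ->]|_] //; case: andP => [[/eqP -> /eqP ->]|_].
have i0 : 0 < i by lia. have j0 : 0 < j by lia.
(* [f] tells whether the action is nontrivial. The bottom side for [i = m] and the right side for
   [j = n] are not edges of the graph, whence the guards on [f] below. *)
set f := raisable c i j || lowerable c i j.
have -> : local_sides m n i j (edge_of c i j true, edge_of c i.+1 j true,
   edge_of c i j false, edge_of c i j.+1 false)
  = (edge_of c i j true (+) f, edge_of c i.+1 j true (+) ((i < m) && f),
     edge_of c i j false (+) f, edge_of c i j.+1 false (+) ((j < n) && f)).
  rewrite /local_sides Z /f /raisable /lowerable /edge_of i0 j0 im jn /=.
  rewrite ?addnS ?addSn /=.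
  have -> : (i == m) = ~~ (i < m) by lia.
  have -> : (j == n) = ~~ (j < n) by lia.
  case: (i < m); case: (j < n); case: (odd (i + j));
  case: (c i j == c i.-1 j); case: (c i j == c i j.-1);
  case: (c i.+1 j == c i j); case: (c i j.+1 == c i j) => //.
have fij : flip_on (pred1 (i, j)) c i j =
    if raisable c i j then (c i j).+1 else if lowerable c i j then (c i j).-1 else c i j.
  by rewrite /flip_on /= eqxx /flip Z.
have fne x y : (x == i) && (y == j) = false -> flip_on (pred1 (i, j)) c x y = c x y.
  by rewrite /flip_on /= xpair_eqE => ->.
case: Hc => c0 c0' cv ch.
have ct := cv i.-1 j. have cl := ch i j.-1. have cb := cv i j. have cr := ch i j.
rewrite !prednK // in ct cl.
have {}ct := ct im jn. have {}cl := cl im jn.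
rewrite !inE /=; case: h.
- case: andP => [[/eqP -> /eqP ->]|/andP/negbTE n1].
    rewrite /edge_of fij fne; last lia.
    rewrite /f /raisable /lowerable i0 im jn /=.
    case: (odd _); case: (eqVneq (c i j) (c i.-1 j)) => e1;
      case: (eqVneq (c i j) (c i j.-1)) => e2 //=;
      do 2?[case: (_ ==> _) => //=]; lia.
  case: andP => [[/eqP -> /eqP ->]|/andP/negbTE n2].
    rewrite /edge_of fij fne; last lia.
    rewrite /f /raisable /lowerable jn /= ?addSn /=.
    case: ltnP cb => //= lim /(_ isT jn) cb.
    case: (odd _); case: (eqVneq (c i j) (c i.-1 j)) => e1;
      case: (eqVneq (c i j) (c i j.-1)) => e2 //=;
      case: (eqVneq (c i.+1 j) (c i j)) => e3 //=;
      do 2?[case: (_ ==> _) => //=]; lia.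
  rewrite /edge_of fne //; case: (posnP a) => [->//|a0].
  by rewrite fne //; lia.
- case: andP => [[/eqP -> /eqP ->]|/andP/negbTE n1].
    rewrite /edge_of fij fne; last lia.
    rewrite /f /raisable /lowerable j0 im jn /=.
    case: (odd _); case: (eqVneq (c i j) (c i.-1 j)) => e1;
      case: (eqVneq (c i j) (c i j.-1)) => e2 //=;
      do 2?[case: (_ ==> _) => //=]; lia.
  case: andP => [[/eqP -> /eqP ->]|/andP/negbTE n2].
    rewrite /edge_of fij fne; last lia.
    rewrite /f /raisable /lowerable im /= ?addnS /=.
    case: (ltnP j n) cr => //= ljn /(_ im isT) cr.
    case: (odd _); case: (eqVneq (c i j) (c i.-1 j)) => e1;
      case: (eqVneq (c i j) (c i j.-1)) => e2 //=;
      case: (eqVneq (c i j.+1) (c i j)) => e3 //=;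
      do 2?[case: (_ ==> _) => //=]; lia.
  rewrite /edge_of fne //; case: (posnP b) => [->//|b0]; first by rewrite andbF.
  by rewrite fne //; lia.
Qed.

Lemma eq_flip c c' i j : c i j = c' i j ->
  (0 < i -> 0 < j -> [/\ c i.-1 j = c' i.-1 j, c i j.-1 = c' i j.-1,
     c i.+1 j = c' i.+1 j & c i j.+1 = c' i j.+1]) ->
  flip c i j = flip c' i j.
Proof.
move=> E0 E; rewrite /flip /raisable /lowerable E0.
by case: i j E0 E => [|i] [|j] //= E0 /(_ isT isT)[-> -> -> ->].
Qed.

Lemma flip_neighbours c i j : corner_sum c -> 0 < i <= m -> 0 < j <= n ->
  [/\ c i.-1 j <= flip c i j <= (c i.-1 j).+1,
      c i j.-1 <= flip c i j <= (c i j.-1).+1,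
      i < m -> flip c i j <= c i.+1 j <= (flip c i j).+1
    & j < n -> flip c i j <= c i j.+1 <= (flip c i j).+1].
Proof.
move=> [c0 c0' cv ch] /andP[i0 im] /andP[j0 jn].
have ct := cv i.-1 j. have cl := ch i j.-1. have cb := cv i j. have cr := ch i j.
rewrite !prednK // in ct cl.
have {}ct := ct im jn. have {}cl := cl im jn.
have {}cb lm := cb lm jn. have {}cr := cr im.
rewrite /flip /raisable /lowerable (gtn_eqF i0) (gtn_eqF j0) /=.
case: (eqVneq (c i j) (c i.-1 j)) => e1; case: (eqVneq (c i j) (c i j.-1)) => e2 //=;
  case: (ltnP i m) => h1 //=; case: (ltnP j n) => h2 //=;
  try (have := cb h1); try (have := cr h2) => //=;
  try case: (eqVneq (c i.+1 j) (c i j)) => e3 //=;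
  try case: (eqVneq (c i j.+1) (c i j)) => e4 //=;
  split => //; lia.
Qed.

(** Adjacent squares have opposite parity, so at most one of two adjacent values moves, and
    [flip_neighbours] covers that case. *)
Lemma flip_on_corner_sum (s : pred (nat * nat)) b c :
  (forall p, s p -> odd (p.1 + p.2) = b) -> corner_sum c ->
  corner_sum (flip_on s c).
Proof.
move=> sb Hc; case: (Hc) => c0 c0' cv ch.
have flip0 j : flip c 0 j = c 0 j by [].
have flip0' i : flip c i 0 = c i 0 by rewrite /flip orbT.
split => [j jn|i im|i j im jn|i j im jn]; rewrite /flip_on.
- by rewrite flip0 if_same c0.
- by rewrite flip0' if_same c0'.
- have h := cv i j im jn.
  case: (posnP j) => [->|j0]; first by rewrite !flip0' !if_same !c0' //; lia.
  case: ifP => s1; case: ifP => s2 //.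
  + by have := sb _ s1; have := sb _ s2; rewrite /= ?addSn ?addnS /= => <-; case: odd.
  + case: (posnP i) => [i0|i0]; first by rewrite i0 flip0 -i0.
    by case: (@flip_neighbours c i j) => //; lia.
  + by case: (@flip_neighbours c i.+1 j) => //; lia.
- have h := ch i j im jn.
  case: (posnP i) => [->|i0]; first by rewrite !flip0 !if_same !c0 //; lia.
  case: ifP => s1; case: ifP => s2 //.
  + by have := sb _ s1; have := sb _ s2; rewrite /= ?addSn ?addnS /= => <-; case: odd.
  + case: (posnP j) => [j0|j0]; first by rewrite j0 flip0' -j0.
    by case: (@flip_neighbours c i j) => //; lia.
  + by case: (@flip_neighbours c i j.+1) => //; lia.
Qed.

(** A flip reads, besides its own square, only squares of the other parity, and [s] leaves these
    alone. Hence flips in one class can be done successively or simultaneously. *)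
Lemma flip_flip_on (s : pred (nat * nat)) b c i j :
  (forall p, s p -> odd (p.1 + p.2) = b) -> odd (i + j) = b -> s (i, j) = false ->
  flip (flip_on s c) i j = flip c i j.
Proof.
move=> sb ij sF; have out x y : odd (x + y) = ~~ b -> flip_on s c x y = c x y.
  rewrite /flip_on; case: ifP => // /sb /= ->; by case: (b).
apply: eq_flip => [|i0 j0]; first by rewrite /flip_on sF.
by split; apply: out; rewrite -ij; lia.
Qed.

Lemma foldl_local_action (s : seq (nat * nat)) b c :
  uniq s -> (forall p, p \in s -> [/\ odd (p.1 + p.2) = b, p.1 <= m & p.2 <= n]) ->
  corner_sum c ->
  foldl (@local_action m n) (config_of c) s = config_of (flip_on [in s] c).
Proof.
elim: s c => [|[i j] s IH] c; first by move=> _ _ _; apply: eq_config_of.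
rewrite cons_uniq => /andP[nis us] hs Hc.
have [/= ijb im jn] := hs _ (mem_head _ _).
have p1b p : pred1 (i, j) p -> odd (p.1 + p.2) = b by move=> /eqP ->.
transitivity (foldl (@local_action m n) (local_action (config_of c) (i, j)) s).
  by [].
have hs1 p : p \in s -> [/\ odd (p.1 + p.2) = b, p.1 <= m & p.2 <= n].
  by move=> ps; apply: hs; rewrite inE ps orbT.
rewrite local_action_config_of // IH //; last exact: flip_on_corner_sum p1b Hc.
apply: eq_config_of => x y xm yn.
rewrite {1 3}/flip_on inE.
case: ifP => xys; last by rewrite orbF /flip_on /=.
rewrite orbT; apply: (@flip_flip_on _ b) => //.
  by case: (hs (x, y)) => //; rewrite inE xys orbT.
by apply: contraNF nis => /eqP <-.
Qed.

(** * Gyration as two involutive half-steps *)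

Definition parity_class (b : bool) : pred (nat * nat) :=
  fun p => odd (p.1 + p.2) == b.

Definition half_gyration (b : bool) F : {set Edge m n} :=
  foldl (@local_action m n) F [seq p <- squares m n | odd (p.1 + p.2) == b].

Lemma gyrationE F : gyration F = half_gyration true (half_gyration false F).
Proof.
rewrite /gyration /half_gyration /even_squares /odd_squares.
congr foldl; first congr foldl; apply: eq_filter => p; by case: (odd _).
Qed.

Lemma half_gyration_config_of b c : corner_sum c ->
  half_gyration b (config_of c) = config_of (flip_on (parity_class b) c).
Proof.
move=> Hc; rewrite /half_gyration.
have sqP x y : ((x, y) \in squares m n) = (x <= m) && (y <= n).
  apply/allpairsP/andP => [[[u v] [hu hv [-> ->]]]|[xm yn]].
    by move: hu hv; rewrite !mem_iota.
  by exists (x, y); rewrite !mem_iota.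
rewrite (@foldl_local_action _ b) //.
- apply: eq_config_of => x y xm yn.
  by rewrite /flip_on mem_filter sqP xm yn !andbT.
- apply/filter_uniq/allpairs_uniq; rewrite ?iota_uniq //.
  by move=> [? ?] [? ?].
- by move=> [x y]; rewrite mem_filter sqP => /and3P[/eqP ? ? ?].
Qed.

Lemma half_gyration_pfpl b F : is_pfpl F -> is_pfpl (half_gyration b F).
Proof.
move=> pF; rewrite -(corner_ofK pF) half_gyration_config_of.
  apply/config_of_pfpl/(@flip_on_corner_sum _ b) => [p /eqP //|].
  exact: corner_of_corner_sum.
exact: corner_of_corner_sum.
Qed.

Lemma corner_of_half_gyration b F i j : is_pfpl F -> i <= m -> j <= n ->
  corner_of (half_gyration b F) i j = flip_on (parity_class b) (corner_of F) i j.
Proof.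
move=> pF im jn; have Hc := corner_of_corner_sum pF.
rewrite -{1}(corner_ofK pF) half_gyration_config_of // config_ofK //.
by apply: flip_on_corner_sum Hc => p /eqP; apply.
Qed.

(** The neighbours of a flipped square stay fixed, and raising makes the square lowerable while
    lowering makes it raisable. *)
Lemma flip_onK b c i j : corner_sum c -> i <= m -> j <= n ->
  flip_on (parity_class b) (flip_on (parity_class b) c) i j = c i j.
Proof.
move=> Hc im jn.
rewrite {1}/flip_on; case: ifP => pij; last by rewrite /flip_on pij.
case: (posnP i) => [i0|i0]; first by rewrite i0 /flip /= /flip_on /flip /= if_same.
case: (posnP j) => [j0|j0].
  by rewrite j0 /flip orbT /flip_on /flip orbT if_same.
have E : flip_on (parity_class b) c i j = flip c i j by rewrite /flip_on pij.
have out x y : odd (x + y) = ~~ odd (i + j) -> flip_on (parity_class b) c x y = c x y.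
  by move=> h; rewrite /flip_on /parity_class /= h -(eqP pij) /=; case: odd.
case: (Hc) => c0 c0' cv ch.
have ct := cv i.-1 j. have cl := ch i j.-1. have cb := cv i j. have cr := ch i j.
rewrite !prednK // in ct cl.
have {}ct := ct im jn. have {}cl := cl im jn.
have {}cb lm := cb lm jn. have {}cr := cr im.
have nb : [/\ odd (i.-1 + j) = ~~ odd (i + j), odd (i + j.-1) = ~~ odd (i + j),
    odd (i.+1 + j) = ~~ odd (i + j) & odd (i + j.+1) = ~~ odd (i + j)] by split; lia.
case: nb => /out ot /out ol /out ob /out or_.
have fE c1 : flip c1 i j =
    if raisable c1 i j then (c1 i j).+1 else if lowerable c1 i j then (c1 i j).-1 else c1 i j.
  by rewrite /flip (gtn_eqF i0) (gtn_eqF j0).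
rewrite fE /raisable /lowerable ot ol ob or_ E fE.
case: (boolP (raisable c i j)) => [/and4P[/eqP e1 /eqP e2 e3 e4]|nr].
  by rewrite ifF ?ifT; lia.
case: (boolP (lowerable c i j)) => [/and4P[e1 e2 e3 e4]|nl].
  by rewrite ifT; lia.
by move: nr nl; rewrite /raisable /lowerable => /negbTE -> /negbTE ->.
Qed.

Lemma half_gyrationK b F : is_pfpl F -> half_gyration b (half_gyration b F) = F.
Proof.
move=> pF; have Hc := corner_of_corner_sum pF.
rewrite -{2}(corner_ofK pF) -{1}(corner_ofK pF) !half_gyration_config_of //.
  by apply: eq_config_of => i j im jn; apply: flip_onK.
by apply: flip_on_corner_sum Hc => p /eqP; apply.
Qed.

Lemma gyration_pfpl F : is_pfpl F -> is_pfpl (gyration F).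
Proof. by move=> pF; rewrite gyrationE; do 2?apply: half_gyration_pfpl. Qed.

Lemma gyration_inj F1 F2 : is_pfpl F1 -> is_pfpl F2 ->
  gyration F1 = gyration F2 -> F1 = F2.
Proof.
move=> p1 p2; rewrite !gyrationE => /(congr1 (half_gyration true)).
rewrite !half_gyrationK; try exact: half_gyration_pfpl.
by move=> /(congr1 (half_gyration false)); rewrite !half_gyrationK.
Qed.

(** * Half-steps of gyration as toggles of order ideals *)

Definition ideal_of F : {set Tri m n} :=
  [set x : Tri m n | inP x && (x.2 < corner_of F x.1.1.+1 x.1.2.+1)].

(* On P_{m,n} this is i + j - 2k: no truncation occurs, covers increase it by
   one downwards, and it vanishes at the top element (0,0,0). *)
Definition corank (x : Tri m n) : nat := (x.1.1 - x.2) + (x.1.2 - x.2).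

(* The state of x after toggling it in S, when its lower covers are read in L
   and its upper covers in U. *)
Definition toggled (L S U : {set Tri m n}) (x : Tri m n) : bool :=
  [forall y, lowerP x y ==> (y \in L)] &&
  ((x \notin S) || [exists y, lowerP y x && (y \in U)]).

Lemma lowerP_inP (x y : Tri m n) : lowerP x y -> inP x /\ inP y.
Proof. by case/and3P. Qed.

Lemma lowerP_corank (x y : Tri m n) : lowerP x y -> corank y = (corank x).+1.
Proof.
by rewrite /lowerP /inP /corank => /and3P[hx hy]; case/or4P => /and3P[]; lia.
Qed.

Lemma odd_corank (x : Tri m n) : inP x -> odd (corank x) = odd (x.1.1 + x.1.2).
Proof. rewrite /inP /corank; lia. Qed.

Lemma lower_coversP F (x : Tri m n) : is_pfpl F -> inP x ->
  let: (i, j, k) := (x.1.1 : nat, x.1.2 : nat, x.2 : nat) in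
  let c := corner_of F in
  [forall y, lowerP x y ==> (y \in ideal_of F)] =
  [&& k <= c i j.+1, k <= c i.+1 j, (i.+1 < m) ==> (k < c i.+2 j.+1)
    & (j.+1 < n) ==> (k < c i.+1 j.+2)].
Proof.
case: x => [[i j] k] pF; rewrite /inP /= => /andP[kj ki].
have [im jn km] := And3 (ltn_ord i) (ltn_ord j) (ltn_ord k).
apply/forallP/and4P => [H|[h1 h2 h3 h4] [[i' j'] k']].
- have step a b d (am : a < m) (bn : b < n) (dm : d < m) :
      lowerP (i, j, k) (Ordinal am, Ordinal bn, Ordinal dm) ->
      d < corner_of F a.+1 b.+1.
    move=> L; have := H (Ordinal am, Ordinal bn, Ordinal dm).
    by rewrite L inE /= => /andP[].
  split.
  (* For [k = 0] this lower cover does not exist and the inequality is vacuous; otherwise [k <= i]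
     makes [i] positive. *)
  + case: (posnP k) => [->//|k0].
    have am : i.-1 < m by lia. have dm : k.-1 < m by lia.
    by have := step _ _ _ am jn dm; rewrite /lowerP /inP /= !prednK ?eqxx; lia.
  + case: (posnP k) => [->//|k0].
    have am : j.-1 < n by lia. have dm : k.-1 < m by lia.
    by have := step _ _ _ im am dm; rewrite /lowerP /inP /= !prednK ?eqxx; lia.
  + apply/implyP => am.
    by have := step _ _ _ am jn km; rewrite /lowerP /inP /= ?eqxx; lia.
  + apply/implyP => am.
    by have := step _ _ _ im am km; rewrite /lowerP /inP /= ?eqxx; lia.
- apply/implyP; rewrite inE /lowerP /= => /and3P[_ -> /=].
  have i'm := ltn_ord i'; have j'n := ltn_ord j'.
  case/or4P => /and3P[/eqP e1 /eqP e2 /eqP e3].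
  + by move: h3; rewrite -e1 i'm e2 e3.
  + by move: h4; rewrite -e2 j'n e1 e3.
  + by rewrite e1 e2 -ltnS e3.
  + by rewrite e1 e2 -ltnS e3.
Qed.

Lemma upper_coversP F (x : Tri m n) : is_pfpl F -> inP x ->
  let: (i, j, k) := (x.1.1 : nat, x.1.2 : nat, x.2 : nat) in
  let c := corner_of F in
  [exists y, lowerP y x && (y \in ideal_of F)] =
  [|| k < c i j.+1, k < c i.+1 j, (i.+1 < m) && (k.+1 < c i.+2 j.+1)
    | (j.+1 < n) && (k.+1 < c i.+1 j.+2)].
Proof.
case: x => [[i j] k] pF; rewrite /inP /= => /andP[kj ki].
have [im jn km] := And3 (ltn_ord i) (ltn_ord j) (ltn_ord k).
have Hc := corner_of_corner_sum pF.
apply/existsP/or4P => [[[[i' j'] k']]|H].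
- rewrite /lowerP !inE /= => /andP[/and3P[hy _ L] /andP[_ h]].
  have i'm := ltn_ord i'; have j'n := ltn_ord j'.
  case/or4P: L => /and3P[/eqP e1 /eqP e2 /eqP e3].
  + by apply: Or41; rewrite e1 e2 e3.
  + by apply: Or42; rewrite e1 e2 e3.
  + by apply: Or43; rewrite e1 i'm e2 e3.
  + by apply: Or44; rewrite e1 e2 j'n e3.
- have step a b d : a < m -> b < n -> d < m ->
      (forall (am : a < m) (bn : b < n) (dm : d < m),
         lowerP (Ordinal am, Ordinal bn, Ordinal dm) (i, j, k)) ->
      d < corner_of F a.+1 b.+1 ->
      exists y, lowerP y (i, j, k) && (y \in ideal_of F).
    move=> am bn dm L h; exists (Ordinal am, Ordinal bn, Ordinal dm).
    by have := L am bn dm; rewrite inE => /[dup] /lowerP_inP[-> _] -> /=.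
  (* The bound of a corner sum by both of its indices ensures that each candidate upper cover lies
     in the poset. *)
  have /andP[a1 a2] := @corner_sum_le _ i j.+1 Hc (ltnW im) jn.
  have /andP[a3 a4] := @corner_sum_le _ i.+1 j Hc im (ltnW jn).
  case: H => [h|h|/andP[am h]|/andP[bn h]].
  + by apply: (step i.-1 j k); rewrite /lowerP /inP /= ?prednK //; lia.
  + by apply: (step i j.-1 k); rewrite /lowerP /inP /= ?prednK //; lia.
  + have /andP[b1 b2] := @corner_sum_le _ i.+2 j.+1 Hc am jn.
    by apply: (step i.+1 j k.+1); rewrite /lowerP /inP /= //; lia.
  + have /andP[b1 b2] := @corner_sum_le _ i.+1 j.+2 Hc im bn.
    by apply: (step i j.+1 k.+1); rewrite /lowerP /inP /= //; lia.
Qed.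

(** The elements over one square share its parity, and those in the ideal form an initial segment in
    [k]. Toggling can only add the next element or remove the last one, exactly when the square is
    raisable or lowerable. *)
Lemma half_gyration_toggled b F (x : Tri m n) : is_pfpl F -> inP x ->
  odd (corank x) = b ->
  (x \in ideal_of (half_gyration b F)) =
    toggled (ideal_of F) (ideal_of F) (ideal_of F) x.
Proof.
move=> pF Px; rewrite odd_corank // => xb.
have Hc := corner_of_corner_sum pF.
rewrite /toggled lower_coversP // upper_coversP // !inE Px.
case: x Px xb => [[i j] k] /= Px xb.
have [im jn km] := And3 (ltn_ord i) (ltn_ord j) (ltn_ord k).
rewrite corner_of_half_gyration // /flip_on /parity_class /= ?addnS ?addSn /= ?negbK.
rewrite xb eqxx /flip /= /raisable /lowerable.
move: (corner_of F) Hc => c [c0 c0' cv ch] {pF Px xb}.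
have ct := cv i j.+1 im jn. have cl := ch i.+1 j im jn.
have cb := cv i.+1 j.+1. have cr := ch i.+1 j.+1.
case: (ltnP i.+1 m) cb => [h1 /(_ isT jn)|h1] cb;
case: (ltnP j.+1 n) cr => [h2 /(_ im isT)|h2] cr /=.
all: case: ifP => e1; [lia|case: ifP => e2; lia].
Qed.

Lemma half_gyration_fixed b F (x : Tri m n) : is_pfpl F ->
  odd (corank x) = ~~ b -> (x \in ideal_of (half_gyration b F)) = (x \in ideal_of F).
Proof.
move=> pF xb; rewrite !inE; case Px : (inP x) => //=.
rewrite corner_of_half_gyration ?ltn_ord // /flip_on /parity_class.
by rewrite [_ + _]/= ?addnS ?addSn /= ?negbK -odd_corank // xb; case: (b).
Qed.

Lemma ideal_closed X : (forall x, x \in X -> inP x) ->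
  (forall x y, x \in X -> lowerP x y -> y \in X) -> is_ideal X.
Proof.
move=> XP XL; split=> // x y xX /connectP[p pth ->].
elim: p x xX pth => //= z p IH x xX /andP[xz /IH]; apply; exact: XL xz.
Qed.

Lemma ideal_lower X x y : is_ideal X -> x \in X -> lowerP x y -> y \in X.
Proof. by case=> _ H xX xy; apply: H xX _; apply: connect1. Qed.

Lemma ideal_ofE F (x : Tri m n) : inP x ->
  (x \in ideal_of F) = (x.2 < corner_of F x.1.1.+1 x.1.2.+1).
Proof. by rewrite inE => ->. Qed.

Lemma ideal_of_ideal F : is_pfpl F -> is_ideal (ideal_of F).
Proof.
move=> pF; apply: ideal_closed => [x|x y]; first by rewrite inE => /andP[].
move=> xF xy; have [Px Py] := lowerP_inP xy.
suff /forallP/(_ y) : [forall z, lowerP x z ==> (z \in ideal_of F)] by rewrite xy.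
move: xF; rewrite ideal_ofE // lower_coversP // => xF.
case: x {y xy Py} Px xF => [[i j] k] /= Px xF.
have [im jn] := conj (ltn_ord i) (ltn_ord j).
have [c0 c0' cv ch] := corner_of_corner_sum pF.
have ct := cv i j.+1 im jn. have cl := ch i.+1 j im jn.
have cb := cv i.+1 j.+1. have cr := ch i.+1 j.+1.
case: (ltnP i.+1 m) cb => [h1 /(_ isT jn)|h1] cb;
case: (ltnP j.+1 n) cr => [h2 /(_ im isT)|h2] cr /=; lia.
Qed.

Lemma ideal_of_inj F1 F2 : is_pfpl F1 -> is_pfpl F2 ->
  ideal_of F1 = ideal_of F2 -> F1 = F2.
Proof.
move=> p1 p2 E.
rewrite -(corner_ofK p1) -(corner_ofK p2); apply: eq_config_of.
have C1 := corner_of_corner_sum p1; have C2 := corner_of_corner_sum p2.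
case=> [|i] [|j] im jn.
- by rewrite /corner_of !big_geq.
- by case: C1 C2 => [h _ _ _] [h' _ _ _]; rewrite h ?h'.
- by rewrite /corner_of !big_geq.
have mem k : k <= i -> k <= j ->
    (k < corner_of F1 i.+1 j.+1) = (k < corner_of F2 i.+1 j.+1).
  move=> ki kj; have km : k < m by lia.
  have /setP/(_ (Ordinal im, Ordinal jn, Ordinal km)) := E.
  by rewrite !inE /inP /= ki kj.
have /andP[a1 a2] := corner_sum_le C1 im jn.
have /andP[b1 b2] := corner_sum_le C2 im jn.
(* If the corner sums differ, the smaller one taken as [k] is in range and belongs to only one of
   the two segments. *)
case: (ltngtP (corner_of F1 i.+1 j.+1) (corner_of F2 i.+1 j.+1)) => // h.
- by have := mem (corner_of F1 i.+1 j.+1); rewrite h ltnn; lia.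
- by have := mem (corner_of F2 i.+1 j.+1); rewrite h ltnn; lia.
Qed.

(** * Configurations from order ideals *)

Definition has_tri X (i j k : nat) : bool :=
  [exists x in X, [&& (x.1.1 : nat) == i, (x.1.2 : nat) == j & (x.2 : nat) == k]].

(** The length of the initial segment of [X] over the square; [find] returns [m] if no [k < m] is
    missing. *)
Definition corner_of_ideal X (i j : nat) : nat :=
  if (i == 0) || (j == 0) then 0
  else find (fun k => ~~ has_tri X i.-1 j.-1 k) (iota 0 m).

Lemma has_triP X i j k (im : i < m) (jn : j < n) (km : k < m) :
  has_tri X i j k = ((Ordinal im, Ordinal jn, Ordinal km) \in X).
Proof.
apply/existsP/idP => [[[[i' j'] k']] /andP[h /= /and3P[/eqP e1 /eqP e2 /eqP e3]]|h].
  by congr (_ \in X): h; congr (_, _, _); apply: val_inj.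
by exists (Ordinal im, Ordinal jn, Ordinal km); rewrite h !eqxx.
Qed.

Lemma has_tri_inP X i j k : is_ideal X -> has_tri X i j k ->
  [/\ i < m, j < n, k <= i & k <= j].
Proof.
move=> [XP _] /existsP[[[i' j'] k']].
case/andP => /XP hP /= /and3P[/eqP <- /eqP <- /eqP <-].
by move: hP; rewrite /inP /= => /andP[-> ->]; rewrite !ltn_ord.
Qed.

Lemma has_tri_lower X i j k i' j' k' : is_ideal X -> has_tri X i j k ->
  i' < m -> j' < n -> k' <= i' -> k' <= j' ->
  [|| [&& i' == i.+1, j' == j & k' == k], [&& i' == i, j' == j.+1 & k' == k],
      [&& i'.+1 == i, j' == j & k'.+1 == k] | [&& i' == i, j'.+1 == j & k'.+1 == k]] ->
  has_tri X i' j' k'.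
Proof.
move=> HX h im' jn' ki' kj' L; have [im jn ki kj] := has_tri_inP HX h.
have km : k < m by lia. have km' : k' < m by lia.
move: h; rewrite (has_triP X im jn km) (has_triP X im' jn' km').
by move=> /(ideal_lower HX); apply; rewrite /lowerP /inP /= ki kj ki' kj'.
Qed.

(** The elements of an ideal over a square form an initial segment, since (i,j,k) covers
    (i-1,j,k-1), which covers (i,j,k-1). *)
Lemma lt_corner_of_ideal X i j k : is_ideal X ->
  (k < corner_of_ideal X i.+1 j.+1) = has_tri X i j k.
Proof.
move=> HX; rewrite /corner_of_ideal /=.
set a := fun _ => _; apply/idP/idP => [h|h].
  have := before_find 0 h; have := find_size a (iota 0 m); rewrite size_iota => fm.
  by rewrite nth_iota ?add0n /a; [move=> /negbFE|lia].
rewrite ltnNge; apply/negP => fk.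
have [im jn ki kj] := has_tri_inP HX h.
have fs : find a (iota 0 m) < m by lia.
have := @nth_find _ 0 a (iota 0 m); rewrite has_find size_iota fs => /(_ isT).
rewrite nth_iota // add0n /a => /negP; apply; rewrite -/a.
(* Descend from [k] to the first missing value one step at a time, contradicting that it is
   missing. *)
rewrite -(subKn fk); move: (k - _) (leq_subr (find a (iota 0 m)) k) => d.
elim: d => [|d IH] dk; first by rewrite subn0.
have {}IH := IH (ltnW dk).
have [im1 jn1 ki1 kj1] := has_tri_inP HX IH.
have E : (k - d) = (k - d.+1).+1 by lia.
case: (posnP i) => [i0|i0]; first by lia.
have st : has_tri X i.-1 j (k - d.+1).
  by apply: (has_tri_lower HX IH); lia.
by apply: (has_tri_lower HX st); lia.
Qed.

(** The covers that increase [i] or [j] give monotonicity, and those that decrease [k] give steps of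
    at most one. The bounds [bnd] and [bnd'] handle the steps out of the zero row and column. *)
Lemma corner_of_ideal_corner_sum X : is_ideal X -> corner_sum (corner_of_ideal X).
Proof.
move=> HX; have lt := lt_corner_of_ideal _ _ _ HX.
have bnd i j : corner_of_ideal X i.+1 j.+1 <= i.+1.
  case E : (corner_of_ideal X i.+1 j.+1) => [|k] //.
  by have := lt i j k; rewrite E leqnn => /esym/(has_tri_inP HX)[]; lia.
have bnd' i j : corner_of_ideal X i.+1 j.+1 <= j.+1.
  case E : (corner_of_ideal X i.+1 j.+1) => [|k] //.
  by have := lt i j k; rewrite E leqnn => /esym/(has_tri_inP HX)[]; lia.
have row0 j : corner_of_ideal X 0 j = 0 by [].
have col0 i : corner_of_ideal X i 0 = 0 by rewrite /corner_of_ideal orbT.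
have le_of a b : (forall k, k < a -> k < b) -> a <= b.
  by case: a => // a; apply.
split => // [[|i] [|j]|[|i] [|j]] im jn; rewrite ?row0 ?col0 ?leqnn //=.
- apply/andP; split; apply: le_of => k; rewrite ?lt => h.
    have [? ? ? ?] := has_tri_inP HX h.
    by apply: (has_tri_lower HX h); lia.
  case: k h => // k h; rewrite ltnS lt.
  have [? ? ? ?] := has_tri_inP HX h.
  by apply: (has_tri_lower HX h); lia.
- apply/andP; split; apply: le_of => k; rewrite ?lt => h.
    have [? ? ? ?] := has_tri_inP HX h.
    by apply: (has_tri_lower HX h); lia.
  case: k h => // k h; rewrite ltnS lt.
  have [? ? ? ?] := has_tri_inP HX h.
  by apply: (has_tri_lower HX h); lia.
Qed.

Definition config_of_ideal X : {set Edge m n} := config_of (corner_of_ideal X).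

Lemma config_of_ideal_pfpl X : is_ideal X -> is_pfpl (config_of_ideal X).
Proof. by move=> HX; apply/config_of_pfpl/corner_of_ideal_corner_sum. Qed.

Lemma config_of_idealK X : is_ideal X -> ideal_of (config_of_ideal X) = X.
Proof.
move=> HX; apply/setP => -[[i j] k]; rewrite inE /=.
rewrite config_ofK ?ltn_ord //; last exact: corner_of_ideal_corner_sum.
rewrite lt_corner_of_ideal // (has_triP X (ltn_ord i) (ltn_ord j) (ltn_ord k)).
have -> : (Ordinal (ltn_ord i), Ordinal (ltn_ord j), Ordinal (ltn_ord k)) = (i, j, k).
  by congr (_, _, _); apply: val_inj.
by apply/andb_idl => h; case: HX => /(_ _ h).
Qed.

(** * Rowmotion as a sweep of toggles from the top *)

(** An element outside [X] with all lower covers in [X] is itself minimal outside; any other element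
    of the image lies below a minimal one through an upper cover that is also in the image. *)
Lemma rowmotion_toggled X (x : Tri m n) : is_ideal X -> inP x ->
  (x \in rowmotion X) = toggled X X (rowmotion X) x.
Proof.
move=> HX Px; have [XP XL] := HX.
(* Strict monotonicity of the corank rules out that a lower cover of [x] equals the minimal element
   above [x]. *)
have min_corank (y z : Tri m n) : Defs.leP y z -> z != y -> corank z < corank y.
  case/connectP => p; elim: p z => [|w p IH] z /=; first by move=> _ ->; rewrite eqxx.
  move=> /andP[zw pw] e _; have := lowerP_corank zw.
  by case: (eqVneq w y) => [<-|ne]; [lia|have := IH _ pw e ne; lia].
rewrite /toggled; apply/idP/andP.
- rewrite inE => /existsP[y /andP[my xy]].
  case/and3P: (my) => Py yX /forallP ymin.
  split.
    apply/forallP => z; apply/implyP => xz.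
    have [_ Pz] := lowerP_inP xz.
    have zy : Defs.leP z y by apply: connect_trans xy _; apply: connect1.
    apply: contraT => zX; have := ymin z; rewrite Pz zX zy /= => /eqP ez.
    have := lowerP_corank xz; rewrite ez => e.
    case: (eqVneq y x) e => [->|ne] e; first by lia.
    by have := min_corank _ _ xy ne; lia.
  (* The last step of a path of covers from [y] down to [x] provides the upper cover of [x]. *)
  case/connectP: (xy) => p; case/lastP: p => [|p w] /=.
    by move=> _ ->; rewrite yX.
  rewrite rcons_path last_rcons => /andP[pth lw] ->.
  apply/orP; right; apply/existsP; exists (last y p); rewrite lw /= inE.
  apply/existsP; exists y; rewrite my /=.
  by apply/connectP; exists p.
- case=> /forallP lowX /orP[xX|/existsP[y /andP[yx]]].
    rewrite inE; apply/existsP; exists x; rewrite /Defs.leP connect0 andbT.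
    apply/and3P; split=> //; apply/forallP => z.
    apply/implyP => /andP[/andP[Pz zX] /connectP[[|w p] /=]]; first by move=> _ ->.
    move=> /andP[xw pth] ez; have := lowX w; rewrite xw /= => wX.
    suff : z \in X by rewrite (negbTE zX).
    by apply: XL wX _; apply/connectP; exists p.
  rewrite !inE => /existsP[z /andP[mz yz]]; apply/existsP; exists z.
  by rewrite mz /=; apply: connect_trans yz _; apply: connect1.
Qed.

Lemma rowmotion_inP X (x : Tri m n) : x \in rowmotion X -> inP x.
Proof.
rewrite inE => /existsP[y /andP[/and3P[Py _ _] /connectP[p]]].
elim: p y Py => [|w p IH] y Py /=; first by move=> _ ->.
by move=> /andP[/lowerP_inP[_ Pw] pth]; apply: IH.
Qed.

(** * The equivariant bijection *)

(* The half-step q and the half-step 2 (q / 2) agree on elements of corank q,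
   since even half-steps do not toggle elements of odd corank. *)
Definition orbit_ideal F : {set Tri m n} :=
  [set x | x \in ideal_of (iter (corank x)./2 (@gyration m n) F)].

Lemma iter_gyration_pfpl k F : is_pfpl F -> is_pfpl (iter k (@gyration m n) F).
Proof. by move=> pF; elim: k => //= k; apply: gyration_pfpl. Qed.

Lemma mem_ideal_of_inP F x : x \in ideal_of F -> inP x.
Proof. by rewrite inE => /andP[]. Qed.

Lemma gyration_even F (x : Tri m n) : is_pfpl F -> ~~ odd (corank x) ->
  (x \in ideal_of (gyration F)) = (x \in ideal_of (half_gyration false F)).
Proof.
move=> pF xo; rewrite gyrationE half_gyration_fixed ?(negbTE xo) //.
exact: half_gyration_pfpl.
Qed.

Lemma mem_orbit_ideal F (x : Tri m n) :
  (x \in orbit_ideal F) = (x \in ideal_of (iter (corank x)./2 (@gyration m n) F)).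
Proof. by rewrite inE. Qed.

(** It suffices to read both ends of a cover in one common state. If the upper end has even corank,
    they use the same iterate; if odd, the state after the next even half-step serves both, as it
    does not move the upper end and the following odd half-step does not move the lower end. *)
Lemma orbit_ideal_ideal F : is_pfpl F -> is_ideal (orbit_ideal F).
Proof.
move=> pF; apply: ideal_closed => [x|x y]; rewrite !mem_orbit_ideal.
  exact: mem_ideal_of_inP.
move=> xF xy; move: xF.
have qy := lowerP_corank xy.
case xo: (odd (corank x)).
- have -> : (corank y)./2 = (corank x)./2.+1 by lia.
  rewrite iterS; move: (iter _ _ _) (iter_gyration_pfpl (corank x)./2 pF) => F' pF'.
  rewrite gyration_even ?qy /= ?xo //.
  rewrite -(@half_gyration_fixed false) // => xF; apply: ideal_lower xF xy.
  exact/ideal_of_ideal/half_gyration_pfpl.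
- have -> : (corank y)./2 = (corank x)./2 by lia.
  by move=> xF; apply: ideal_lower xF xy; apply/ideal_of_ideal/iter_gyration_pfpl.
Qed.

Lemma eq_toggled (L L' S S' U U' : {set Tri m n}) (x : Tri m n) :
  (forall y, lowerP x y -> (y \in L) = (y \in L')) ->
  (x \in S) = (x \in S') ->
  (forall y, lowerP y x -> (y \in U) = (y \in U')) ->
  toggled L S U x = toggled L' S' U' x.
Proof.
move=> EL ES EU; rewrite /toggled ES; congr (_ && (_ || _)).
  by apply: eq_forallb => y; case xy : (lowerP x y) => //=; apply: EL.
by apply: eq_existsb => y; case yx : (lowerP y x) => //=; apply: EU.
Qed.

(** The half-step that toggles [x] finds the lower covers as recorded along the orbit of [F] and the
    upper covers, one half-step ahead, as recorded along the orbit of [gyration F]. This is the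
    recursion of [rowmotion_toggled]. *)
Lemma orbit_ideal_gyration_toggled F (x : Tri m n) : is_pfpl F -> inP x ->
  (x \in orbit_ideal (gyration F)) =
    toggled (orbit_ideal F) (orbit_ideal F) (orbit_ideal (gyration F)) x.
Proof.
move=> pF Px; rewrite mem_orbit_ideal -iterSr iterS.
have pF' := iter_gyration_pfpl (corank x)./2 pF.
case xo: (odd (corank x)).
- rewrite gyrationE (half_gyration_toggled _ Px) //; last exact: half_gyration_pfpl.
  apply: eq_toggled => [y xy||y yx].
  + have qy := lowerP_corank xy.
    rewrite mem_orbit_ideal; have -> : (corank y)./2 = (corank x)./2.+1 by lia.
    by rewrite iterS gyration_even // qy /= xo.
  + by rewrite mem_orbit_ideal half_gyration_fixed.
  + have qx := lowerP_corank yx.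
    rewrite mem_orbit_ideal; have -> : (corank y)./2 = (corank x)./2 by lia.
    by rewrite -iterSr iterS gyration_even //; move: xo; rewrite qx /= => ->.
- rewrite gyration_even ?xo // (half_gyration_toggled _ Px) //.
  apply: eq_toggled => [y xy||y yx]; rewrite mem_orbit_ideal //.
  + have qy := lowerP_corank xy.
    by have -> : (corank y)./2 = (corank x)./2 by lia.
  + have qx := lowerP_corank yx.
    by rewrite -iterSr; have -> : (corank y)./2.+1 = (corank x)./2 by lia.
Qed.

Lemma orbit_ideal_gyration F : is_pfpl F ->
  orbit_ideal (gyration F) = rowmotion (orbit_ideal F).
Proof.
move=> pF; apply/setP => x.
(* In the recursion the image itself enters only through upper covers, whose corank is smaller. *)
have [q] := ubnP (corank x); elim: q x => // q IH x qx.
case Px : (inP x); last first.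
  transitivity false; last by apply: esym; apply: contraFF Px; apply: rowmotion_inP.
  by apply: contraFF Px; rewrite mem_orbit_ideal; apply: mem_ideal_of_inP.
rewrite orbit_ideal_gyration_toggled // rowmotion_toggled //; last first.
  exact: orbit_ideal_ideal.
by apply: eq_toggled => // y yx; apply: IH; have := lowerP_corank yx; lia.
Qed.

Lemma iter_gyration_inj k F1 F2 : is_pfpl F1 -> is_pfpl F2 ->
  iter k (@gyration m n) F1 = iter k (@gyration m n) F2 -> F1 = F2.
Proof.
move=> p1 p2; elim: k => //= k IH /gyration_inj E.
by apply/IH/E; apply: iter_gyration_pfpl.
Qed.

Lemma orbit_ideal_inj F1 F2 : is_pfpl F1 -> is_pfpl F2 ->
  orbit_ideal F1 = orbit_ideal F2 -> F1 = F2.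
Proof.
move=> p1 p2 E.
have Es k : orbit_ideal (iter k (@gyration m n) F1) =
            orbit_ideal (iter k (@gyration m n) F2).
  elim: k => //= k IH.
  by rewrite !orbit_ideal_gyration ?IH //; apply: iter_gyration_pfpl.
(* The exponent [m + n] is at least half of every corank, so each [x] in the ideal of this iterate
   can be read off the orbit ideal of an earlier iterate. *)
apply: (@iter_gyration_inj (m + n)) => //.
apply: ideal_of_inj; try exact: iter_gyration_pfpl.
apply/setP => x.
have -> : m + n = (corank x)./2 + (m + n - (corank x)./2).
  by rewrite subnKC // /corank; case: x => [[[i im] [j jn]] k] /=; lia.
by rewrite !iterD -!mem_orbit_ideal Es.
Qed.

Definition ideal_pred X : bool :=
  [forall x in X, inP x] && [forall x in X, forall y, Defs.leP y x ==> (y \in X)].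

Lemma ideal_predP X : reflect (is_ideal X) (ideal_pred X).
Proof.
apply: (iffP andP) => -[h1 h2]; split.
- exact/forall_inP.
- by move=> x y xX yx; have /forall_inP/(_ x xX)/forallP/(_ y)/implyP := h2; apply.
- exact/forall_inP.
- by apply/forall_inP => x xX; apply/forallP => y; apply/implyP; apply: h2.
Qed.

(* Composing with the bijection [config_of_ideal] gives an injective self-map
   of a finite set. *)
Lemma orbit_ideal_surj X : is_ideal X -> exists2 F, is_pfpl F & orbit_ideal F = X.
Proof.
(* The identity on sets that are not ideals makes [f] total; it stays injective because it preserves
   being an ideal. *)
pose f Y := if ideal_pred Y then orbit_ideal (config_of_ideal Y) else Y.
have f_ideal Y : ideal_pred (f Y) = ideal_pred Y.
  rewrite /f; case: ifP => // /ideal_predP HY.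
  by apply/ideal_predP/orbit_ideal_ideal/config_of_ideal_pfpl.
have f_inj : injective f.
  move=> Y Z E; have := f_ideal Y; rewrite E f_ideal; move: E; rewrite /f.
  case: ideal_predP => HY; case: ideal_predP => HZ // E _.
  rewrite -(config_of_idealK HY) -(config_of_idealK HZ); congr ideal_of.
  by apply: orbit_ideal_inj E; apply: config_of_ideal_pfpl.
move=> /ideal_predP HX; have [g _ gK] := injF_bij f_inj.
have gX : ideal_pred (g X) by rewrite -f_ideal gK.
exists (config_of_ideal (g X)); first exact/config_of_ideal_pfpl/ideal_predP.
by have := gK X; rewrite /f gX.
Qed.

End Configurations.

Theorem theorem4p6 (m n : nat) (hm : 0 < m) (hn : 0 < n) :
  exists Phi : {set Edge m n} -> {set Tri m n},
    [/\ (forall F, is_pfpl F -> is_ideal (Phi F)),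
        (forall F1 F2, is_pfpl F1 -> is_pfpl F2 -> Phi F1 = Phi F2 -> F1 = F2),
        (forall X, is_ideal X -> exists2 F, is_pfpl F & Phi F = X)
      & (forall F, is_pfpl F -> Phi (gyration F) = rowmotion (Phi F))].
Proof.
exists (@orbit_ideal m n); split.
- exact: orbit_ideal_ideal.
- exact: orbit_ideal_inj.
- exact: orbit_ideal_surj.
- exact: orbit_ideal_gyration.
Qed.
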